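(* For all sufficiently large $n$, the Cayley graph of the symmetric group $S_n$ with respect to the generating set $\{(1\,2),(2\,3),\ldots,(n-1\;n)\}$ is a Černý Cayley graph, and the Cayley graph of $S_n$ with respect to the generating set $\{(1\,2),(1\,2\cdots n)\}$ is a Černý Cayley graph.
   Context: For a finite set $X$, $T_X$ is the set of all maps $X\to X$, acting on the right of $X$. An automaton with state set $X$ is a subset $\Sigma\subseteq T_X$, written $(X,\Sigma)$. The free monoid $\Sigma^*$ acts on the right of $X$ via the homomorphism $\Sigma^*\to T_X$ extending the inclusion $\Sigma\hookrightarrow T_X$. A word $w\in\Sigma^*$ is synchronizing if $|Xw|=1$; the automaton is synchronizing if it admits a synchronizing word. If $G$ is a finite group with generating set $\Delta$, elements of $\Delta$ are identified with the right translations $g\mapsto gd$ of $G$, so $\Delta\subseteq T_G$; the automaton $(G,\Delta)$ is the Cayley graph of $G$ with respect to $\Delta$. $(G,\Delta)$ is a Černý Cayley graph if every synchronizing automaton $(G,\Sigma)$ with $\Delta\subseteq\Sigma\subseteq T_G$ admits a synchronizing word of length at most $(|G|-1)^2$. *)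

(* Defs.v *)
From HB Require Import structures.
From mathcomp Require Import all_boot all_fingroup.

Set Implicit Arguments.
Unset Strict Implicit.
Unset Printing Implicit Defensive.

Section Automata.

Variable X : finType.

(* T_X is {ffun X -> X}.  A word over an alphabet Sigma is a sequence of maps
   belonging to Sigma; letters are applied from left to right (right action). *)
Definition word_over (Sigma : {set {ffun X -> X}}) (w : seq {ffun X -> X}) : bool :=
  all [in Sigma] w.

Definition word_act (x : X) (w : seq {ffun X -> X}) : X :=
  foldl (fun (y : X) (s : {ffun X -> X}) => s y) x w.

Definition synchronizing_word (Sigma : {set {ffun X -> X}})
    (w : seq {ffun X -> X}) : Prop :=
  word_over Sigma w /\ #|[set word_act x w | x : X]| = 1.

Definition synchronizing (Sigma : {set {ffun X -> X}}) : Prop :=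
  exists w, synchronizing_word Sigma w.

End Automata.

Section CayleyGraphs.

Variable gT : finGroupType.

Definition right_translation (d : gT) : {ffun gT -> gT} :=
  [ffun g => (g * d)%g].

Definition Cayley_graph (Delta : {set gT}) : {set {ffun gT -> gT}} :=
  [set right_translation d | d in Delta].

(* The group G is the whole of gT.  The requirement that Delta generates G is
   part of the notion, so asserting it for a given Delta includes proving that
   Delta is a generating set. *)
Definition Cerny_Cayley_graph (Delta : {set gT}) : Prop :=
  <<Delta>>%g = [set: gT] /\
  forall Sigma : {set {ffun gT -> gT}},
    Cayley_graph Delta \subset Sigma -> synchronizing Sigma ->
    exists2 w, synchronizing_word Sigma w & size w <= (#|gT| - 1) ^ 2.

End CayleyGraphs.

(* 'S_n acts on {0, ..., n - 1} instead of {1, ..., n}. *)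

Definition adjacent_transpositions (n : nat) : {set 'S_n} :=
  [set tperm i j | i in 'I_n, j in 'I_n & val j == (val i).+1].

(* ordS is the successor modulo n, so this is the n-cycle (1 2 ... n). *)
Definition long_cycle (n : nat) : 'S_n := perm (@ordS_inj n).

(* For 2 <= n the first set below is the singleton of the transposition (1 2). *)
Definition transposition_and_long_cycle (n : nat) : {set 'S_n} :=
  [set tperm i j | i in 'I_n, j in 'I_n & (val i == 0) && (val j == 1)]
  :|: [set long_cycle n].

(* Main.v *)
Require Import Defs.
From mathcomp Require Import all_boot all_order all_fingroup all_algebra zify.

Set Implicit Arguments.
Unset Strict Implicit.
Unset Printing Implicit Defensive.

Import GRing.Theory Num.Theory.

(** Let G be a group of order N in which every element is a product of at most
    d elements of Delta.  A singular letter gives a point with at least two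
    preimages, so a synchronizing word of length 1 + N(N - 2) = (N - 1)^2 is
    obtained as soon as every proper nonempty subset S of G can be enlarged by
    taking its preimage under a word of length at most N ([extension_word]).

    The enlargement is linear algebra over Q.  A letter acts on rational
    functions on G, columns being test functions and rows being measures.  For
    a word w, the number ones * w * (N 1_S - |S|) is N times the growth of S
    under the preimage by w.  It is enough to find words u, v of total length at
    most N - m and a group element g for which u g v makes this number nonzero:
    after v is shortened until it preserves the size of S, the average over g
    vanishes, so some g makes it positive ([averaging], [positive_word]), and
    writing this g as a word costs d.  Hence the total length is at most N when
    d <= m.

    If no such u, g, v existed, the right G-module M_i generated by the measures
    ones * u with |u| <= i would be orthogonal to the span of the functions
    v (N 1_S - |S|) with |v| <= j whenever i + j <= N - m.  Both spaces gain at
    least one dimension at each step, so their dimensions add up to more than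
    N - m; one step at which M_i grows by m at once raises the sum above N
    ([detecting_words]).  Such a jump exists when there is a nonzero subspace E
    meeting the constants trivially, such that a G-module that meets E
    nontrivially exceeds by m any submodule that meets E trivially
    ([rank_jump]).  An isotypic component of an irreducible module of
    degree m is the standard example.

    For the symmetric group the representation theory is replaced by sign
    patterns.  Cut 4k points into k blocks of four and let E consist of the
    vectors symmetric in the first two points and antisymmetric in the last two
    points of every block.  Exchanging the two halves of any set of blocks
    produces 2^k distinct sign patterns under commuting involutions, hence a
    jump of 2^k with k about n/4 ([doubling], [pattern_jump]).  Since the two
    generating sets of the theorem give d = O(n^3), the inequality d <= 2^k
    holds for large n. *)

(** * Spans of matrix products of bounded length *)

Section ProductSpans.

Local Open Scope ring_scope.

Variables (F : fieldType) (n : nat) (I : finType) (P : {set I}).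
Variable f : I -> 'M[F]_n.

Definition mxword (w : seq I) : 'M[F]_n :=
  foldr (fun i A => f i *m A) 1%:M w.

Lemma mxword_cat u v : mxword (u ++ v) = mxword u *m mxword v.
Proof. by elim: u => [|i u IHu] /=; rewrite ?mul1mx // IHu mulmxA. Qed.

Fixpoint wspan p (A : 'M[F]_(p, n)) (i : nat) : 'M[F]_n :=
  if i is i'.+1 then
    (wspan A i' + \sum_(s in P) wspan A i' *m f s)%MS
  else <<A>>%MS.

Lemma wspan_sub p (A : 'M_(p, n)) i : (A <= wspan A i)%MS.
Proof.
elim: i => [|i IHi] /=; first by rewrite genmxE.
exact: submx_trans IHi (addsmxSl _ _).
Qed.

(** The induction is on all [C] simultaneously, since the last letter of a
    product is absorbed into the test matrix [C]. *)
Lemma wspan_mul_neq0 p (A : 'M_(p, n)) i q (C : 'M_(n, q)) :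
  wspan A i *m C != 0 ->
  exists w, [/\ all [in P] w, (size w <= i)%N & A *m mxword w *m C != 0].
Proof.
elim: i q C => [|i IHi] q C /= neC.
  exists [::]; split=> //; rewrite /= mulmx1; apply: contra neC => /eqP/sub_kermxP.
  by move=> AC; apply/eqP/sub_kermxP; rewrite genmxE.
have [/IHi[w [Pw sw neq]]|/negbNE/eqP AC] := boolP (wspan A i *m C != 0).
  by exists w; split; rewrite ?leqW.
have [/exists_inP[s Ps]|] := boolP [exists s in P, wspan A i *m (f s *m C) != 0].
  case/IHi=> w [Pw sw neq]; exists (rcons w s).
  by rewrite all_rcons Ps size_rcons -cats1 mxword_cat /= mulmx1 -!mulmxA in neq *.
rewrite negb_exists_in => /forall_inP noC; case/negP: neC.
apply/eqP/sub_kermxP; rewrite addsmx_sub; apply/andP; split; first exact/sub_kermxP.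
apply/sumsmx_subP => s Ps; apply/sub_kermxP; rewrite -mulmxA.
by apply/eqP/negbNE/noC.
Qed.

(** An increasing chain of spans that stops growing once is stable under all
    letters, hence already contains every product. *)
Lemma wspan_growth p (A : 'M_(p, n)) i :
  (\rank A + i <= \rank (wspan A i))%N \/
  (forall w, all [in P] w -> (A *m mxword w <= wspan A i)%MS).
Proof.
elim: i => [|i [IHi|IHi]]; first by left; rewrite /= genmxE addn0.
  have le_i : (wspan A i <= wspan A i.+1)%MS by apply: addsmxSl.
  have [lt_i|ge_i] := ltnP (\rank (wspan A i)) (\rank (wspan A i.+1)).
    by left; rewrite addnS (leq_ltn_trans IHi).
  right; have {}ge_i : (wspan A i.+1 <= wspan A i)%MS.
    by rewrite -(geq_leqif (mxrank_leqif_sup le_i)).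
  move=> w Pw; apply: submx_trans le_i.
  elim/last_ind: w Pw => [_|w s IHw]; first by rewrite /= mulmx1 wspan_sub.
  rewrite all_rcons -cats1 mxword_cat /= mulmx1 mulmxA => /andP[Ps /IHw le_w].
  apply: submx_trans (submxMr _ le_w) _; apply: submx_trans ge_i.
  by apply: submx_trans (addsmxSr _ _); apply: (sumsmx_sup s).
by right=> w /IHi /submx_trans; apply; apply: addsmxSl.
Qed.

End ProductSpans.

(** * Dimension doubling by commuting involutions *)

Section Doubling.

Local Open Scope ring_scope.

Variables (F : numFieldType) (n : nat).

Lemma involution_rank_split (M Y : 'M[F]_n) :
  Y *m Y = 1%:M -> stablemx M Y ->
  \rank M = (\rank (M :&: eigenspace Y 1)%MS
             + \rank (M :&: eigenspace Y (-1))%MS)%N.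
Proof.
move=> YY MY; rewrite -mxrank_disjoint_sum; last first.
  apply/eqP; rewrite -submx0; apply/rV_subP => v.
  rewrite !sub_capmx => /andP[/andP[_ /eigenspaceP v1] /andP[_ /eigenspaceP]].
  rewrite v1 scale1r scaleN1r => /eqP; rewrite -addr_eq0 -mulr2n -scaler_nat.
  by rewrite scaler_eq0 pnatr_eq0 /= => /eqP->; apply: sub0mx.
apply/eqmx_rank/andP; split; last by rewrite addsmx_sub !capmxSl.
have {1}-> : M = 2^-1 *: (M + M *m Y) + 2^-1 *: (M - M *m Y).
  rewrite -scalerDr addrACA subrr addr0 -mulr2n -scaler_nat scalerA.
  by rewrite mulVf ?pnatr_eq0 // scale1r.
have MYN : (- (M *m Y) <= M)%MS by rewrite eqmx_opp.
apply: addmx_sub_adds; apply: scalemx_sub; rewrite sub_capmx addmx_sub //=.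
  by apply/eigenspaceP; rewrite mulmxDl -mulmxA YY mulmx1 scale1r addrC.
by apply/eigenspaceP; rewrite mulmxBl -mulmxA YY mulmx1 scaleN1r opprB.
Qed.

Lemma stablemx_cap (A B Y : 'M[F]_n) :
  stablemx A Y -> stablemx B Y -> stablemx (A :&: B)%MS Y.
Proof.
move=> AY BY; rewrite sub_capmx.
rewrite (submx_trans (submxMr _ (capmxSl _ _)) AY).
exact: submx_trans (submxMr _ (capmxSr _ _)) BY.
Qed.

(** Write [v T_B] for the product of [v] by the [T b] with [b] in [B].  The
    vectors [v T_B] are simultaneous eigenvectors of the [Y b] with pairwise
    distinct eigenvalue systems, and none of them lies in [M], so they are
    independent modulo [M].  The induction replaces this family by the two
    eigenspaces of one [Y b], which split both [M] and [M'], and into which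
    [v] and [v T_b] place a witness. *)
Lemma doubling k (Y T : nat -> 'M[F]_n) (M M' : 'M[F]_n) (v : 'rV[F]_n) :
  (forall b, (b < k)%N -> Y b *m Y b = 1%:M /\ T b *m T b = 1%:M) ->
  (forall b c, (b < c < k)%N -> [/\ comm_mx (Y b) (Y c), comm_mx (Y b) (T c),
                   comm_mx (T b) (Y c) & comm_mx (T b) (T c)]) ->
  (forall b, (b < k)%N -> [/\ stablemx M (Y b), stablemx M (T b),
                              stablemx M' (Y b) & stablemx M' (T b)]) ->
  (M <= M')%MS -> (v <= M')%MS -> ~~ (v <= M)%MS ->
  (forall b, (b < k)%N -> v *m Y b = v /\ v *m T b *m Y b = - (v *m T b)) ->
  (\rank M + 2 ^ k <= \rank M')%N.
Proof.
elim: k M M' v => [|k IHk] M M' v inv comm stab MM' vM' vM eig.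
  rewrite addn1 rank_ltmx // ltmxE MM' /=.
  by apply: contra vM; apply: submx_trans.
have [[YYk TTk] [eY eT]] := (inv k (ltnSn k), eig k (ltnSn k)).
have [MY MT M'Y M'T] := stab k (ltnSn k).
rewrite (involution_rank_split YYk MY) (involution_rank_split YYk M'Y).
rewrite expnS mul2n -addnn addnACA.
have lift a (u : 'rV_n) : (u <= M')%MS -> ~~ (u <= M)%MS -> u *m Y k = a *: u ->
  (forall b, (b < k)%N -> u *m Y b = u /\ u *m T b *m Y b = - (u *m T b)) ->
  (\rank (M :&: eigenspace (Y k) a)%MS + 2 ^ k
     <= \rank (M' :&: eigenspace (Y k) a)%MS)%N.
  move=> uM' uM uY ueig; apply: (IHk _ _ u) => //.
  - by move=> b lt_b; apply/inv/leqW.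
  - by move=> b c /andP[lt_b lt_c]; apply: comm; rewrite lt_b leqW.
  - move=> b lt_b; have [MYb MTb M'Yb M'Tb] := stab b (leqW lt_b).
    have [cYY _ cTY _] : [/\ comm_mx (Y b) (Y k), comm_mx (Y b) (T k),
                   comm_mx (T b) (Y k) & comm_mx (T b) (T k)].
      by apply: comm; rewrite lt_b ltnSn.
    by split; apply: stablemx_cap => //; apply: comm_mx_stable_eigenspace.
  - by rewrite capmxS.
  - by rewrite sub_capmx uM'; apply/eigenspaceP.
  - by apply: contra uM => /submx_trans; apply; apply: capmxSl.
apply: leq_add; last first.
  apply: (lift _ (v *m T k)) => //.
  - exact: submx_trans (submxMr _ vM') M'T.
  - apply: contra vM => vTM; rewrite -[v]mulmx1 -TTk mulmxA.
    exact: submx_trans (submxMr _ vTM) MT.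
  - by rewrite eT scaleN1r.
  move=> b lt_b; have [eYb eTb] := eig b (leqW lt_b).
  have [_ cYT _ cTT] : [/\ comm_mx (Y b) (Y k), comm_mx (Y b) (T k),
                   comm_mx (T b) (Y k) & comm_mx (T b) (T k)].
    by apply: comm; rewrite lt_b ltnSn.
  split; first by rewrite -mulmxA -cYT mulmxA eYb.
  rewrite -(mulmxA v) -cTT mulmxA -(mulmxA (v *m T b)) -cYT mulmxA eTb.
  by rewrite mulNmx.
apply: (lift _ v) => //; first by rewrite eY scale1r.
by move=> b lt_b; apply/eig/leqW.
Qed.

End Doubling.

(** * Transition matrices of maps and words *)

Section MatrixOfMap.

Local Open Scope ring_scope.

Variable X : finType.
Local Notation N := #|X|.

Definition map_mx_of (s : {ffun X -> X}) : 'M[rat]_N :=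
  \matrix_(i, j) (s (enum_val i) == enum_val j)%:R.

Local Notation wmx := (mxword map_mx_of).

Definition indicator (S : {set X}) : 'cV[rat]_N :=
  \col_i (enum_val i \in S)%:R.

Definition ones : 'rV[rat]_N := const_mx 1.

Definition word_preim (w : seq {ffun X -> X}) (S : {set X}) : {set X} :=
  [set x | word_act x w \in S].

Lemma word_act_cat x (u v : seq {ffun X -> X}) :
  word_act x (u ++ v) = word_act (word_act x u) v.
Proof. exact: foldl_cat. Qed.

Lemma word_over_cat Sigma (u v : seq {ffun X -> X}) :
  word_over Sigma (u ++ v) = word_over Sigma u && word_over Sigma v.
Proof. exact: all_cat. Qed.

Lemma word_preim_cat u v S : word_preim (u ++ v) S = word_preim u (word_preim v S).
Proof. by apply/setP => x; rewrite !inE word_act_cat. Qed.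

Lemma mulmx_map_of_col s (c : 'cV[rat]_N) i :
  (map_mx_of s *m c) i 0 = c (enum_rank (s (enum_val i))) 0.
Proof.
rewrite mxE (bigD1 (enum_rank (s (enum_val i)))) //= mxE enum_rankK eqxx mul1r.
rewrite big1 ?addr0 // => j ne; rewrite mxE; case: eqP => [e|_]; last by rewrite mul0r.
by rewrite e enum_valK eqxx in ne.
Qed.

Lemma wmx_indicator w S : wmx w *m indicator S = indicator (word_preim w S).
Proof.
elim: w => [|s w IHw] /=.
  by rewrite mul1mx; apply/colP => i; rewrite !mxE inE.
apply/colP => i.
by rewrite -mulmxA IHw mulmx_map_of_col !mxE !inE enum_rankK.
Qed.

Lemma ones_tr : ones^T = indicator setT.
Proof. by apply/colP => i; rewrite !mxE inE. Qed.

Lemma wmx_ones w : wmx w *m ones^T = ones^T.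
Proof.
rewrite ones_tr wmx_indicator; congr indicator.
by apply/setP => x; rewrite !inE.
Qed.

Lemma ones_indicator S : ones *m indicator S = (#|S|%:R)%:M.
Proof.
apply/rowP => i; rewrite !mxE ord1 eqxx mulr1n -sum1_card natr_sum /=.
rewrite (reindex_onto enum_rank enum_val) => [|j _]; last exact: enum_valK.
rewrite [RHS]big_mkcond /=; apply: eq_big => x.
  by rewrite enum_rankK eqxx.
by move=> _; rewrite !mxE enum_rankK mul1r; case: (x \in S).
Qed.

(** This is [#|X|] times the component of the indicator of [S] orthogonal to the
    constants; the factor avoids a division. *)
Definition centred (S : {set X}) : 'cV[rat]_N :=
  N%:R *: indicator S - #|S|%:R *: ones^T.

Lemma scalar1_mx_eq0 (a : rat) : (a%:M == 0 :> 'M_1) = (a == 0).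
Proof.
apply/eqP/eqP => [/matrixP/(_ 0 0)|->]; last exact: raddf0.
by rewrite !mxE eqxx mulr1n.
Qed.

Lemma ones_wmx_centred w S :
  ones *m (wmx w *m centred S) = (N%:R * (#|word_preim w S|%:R - #|S|%:R))%:M.
Proof.
rewrite mulmxBr -!scalemxAr wmx_ones wmx_indicator mulmxBr -!scalemxAr.
rewrite ones_tr !ones_indicator cardsT !scale_scalar_mx -raddfB /=.
by rewrite mulrBr [X in _ - X]mulrC.
Qed.

End MatrixOfMap.

(** * The regular representation *)

Section RightTranslations.

Local Open Scope ring_scope.

Variable gT : finGroupType.

Definition rmx (g : gT) : 'M[rat]_#|gT| := map_mx_of (right_translation g).

Lemma map_mx_of_comp (X : finType) (s t r : {ffun X -> X}) :
  (forall x, r x = t (s x)) -> map_mx_of s *m map_mx_of t = map_mx_of r.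
Proof.
move=> rE; apply/matrixP => i j.
transitivity ((map_mx_of s *m col j (map_mx_of t)) i 0).
  by rewrite !mxE; apply: eq_bigr => l _; rewrite !mxE.
by rewrite mulmx_map_of_col !mxE enum_rankK rE.
Qed.

Lemma rmxM g h : rmx (g * h)%g = rmx g *m rmx h.
Proof.
by symmetry; apply: map_mx_of_comp => x; rewrite !ffunE mulgA.
Qed.

Lemma rmx1 : rmx 1%g = 1%:M.
Proof.
apply/matrixP => i j; rewrite !mxE ffunE mulg1.
by rewrite (inj_eq enum_val_inj).
Qed.

Lemma sum_rmx : \sum_g rmx g = (ones gT)^T *m ones gT.
Proof.
apply/matrixP => i j; rewrite summxE mxE big_ord1 !mxE mulr1.
rewrite (bigD1 ((enum_val i)^-1 * enum_val j)%g) //= mxE ffunE mulKVg eqxx.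
rewrite big1 ?addr0 // => g ne; rewrite mxE ffunE; case: eqP => // e.
by rewrite -e mulKg eqxx in ne.
Qed.

Lemma row_rmx (a : 'rV[rat]_#|gT|) g j :
  (a *m rmx g) 0 j = a 0 (enum_rank (enum_val j * g^-1)%g).
Proof.
rewrite mxE (bigD1 (enum_rank (enum_val j * g^-1)%g)) //= mxE ffunE.
rewrite enum_rankK mulgKV eqxx mulr1 big1 ?addr0 // => i ne.
rewrite mxE ffunE; case: eqP => [e|_]; last by rewrite mulr0.
by rewrite -e mulgK enum_valK eqxx in ne.
Qed.

Lemma ones_rmx g : ones gT *m rmx g = ones gT.
Proof. by apply/rowP => j; rewrite row_rmx !mxE. Qed.

Definition rstable (M : 'M[rat]_#|gT|) : Prop :=
  forall g, stablemx M (rmx g).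

Definition rclosure (M : 'M[rat]_#|gT|) : 'M[rat]_#|gT| :=
  (\sum_g M *m rmx g)%MS.

Lemma rclosure_stable M : rstable (rclosure M).
Proof.
move=> h; rewrite sumsmxMr; apply/sumsmx_subP => g _.
by rewrite -mulmxA -rmxM; apply: (sumsmx_sup (g * h)%g).
Qed.

Lemma sub_rclosure M : (M <= rclosure M)%MS.
Proof. by apply: (sumsmx_sup 1%g); rewrite ?rmx1 ?mulmx1. Qed.

Lemma rclosureS M M' : (M <= M')%MS -> (rclosure M <= rclosure M')%MS.
Proof.
move=> MM'; apply/sumsmx_subP => g _.
by apply: (sumsmx_sup g); rewrite ?submxMr.
Qed.

Lemma rclosure_mul_neq0 M q (C : 'M_(_, q)) :
  rclosure M *m C != 0 -> exists g, M *m rmx g *m C != 0.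
Proof.
move=> neC; apply/existsP; apply: contraNT neC.
rewrite negb_exists => /forallP noC; apply/eqP/sub_kermxP/sumsmx_subP => g _.
by apply/sub_kermxP/eqP/negbNE/noC.
Qed.

(** This abstracts the degree of an irreducible module: when [E] is an isotypic
    component, a module that meets [E] contains an irreducible constituent absent
    from a submodule that does not. *)
Definition rank_jump (E : 'M[rat]_#|gT|) (m : nat) : Prop :=
  forall M M', rstable M -> rstable M' -> (M <= M')%MS ->
    (M :&: E)%MS = 0 -> (M' :&: E)%MS != 0 -> (\rank M + m <= \rank M')%N.

End RightTranslations.

(** * Words detecting a function *)

Section Extension.

Local Open Scope ring_scope.

Variables (gT : finGroupType) (Sigma : {set {ffun gT -> gT}}).
Variables (E : 'M[rat]_#|gT|) (m : nat).
Hypotheses (jumpE : rank_jump E m) (E_neq0 : E != 0).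
Hypothesis onesE : (ones gT :&: E)%MS = 0.

Local Notation N := #|gT|.
Local Notation wmx := (mxword (@map_mx_of gT)).

Lemma rstable_full : rstable (1%:M : 'M[rat]_N).
Proof. by move=> g; apply: submx1. Qed.

Let rows i : 'M[rat]_N := rclosure (wspan Sigma (@map_mx_of gT) (ones gT) i).
Let cols (c : 'cV[rat]_N) j : 'M[rat]_N :=
  wspan Sigma (fun s => (map_mx_of s)^T) c^T j.

Lemma mxword_tr (w : seq {ffun gT -> gT}) :
  mxword (fun s => (map_mx_of s)^T) w = (wmx (rev w))^T.
Proof.
elim: w => [|s w IHw] /=; first by rewrite trmx1.
by rewrite rev_cons -cats1 mxword_cat trmx_mul IHw /= mulmx1.
Qed.

(** Otherwise [rows i] and [cols c j] are orthogonal for [i + j <= K], where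
    [K = N - m].  Their ranks are at least [i + 1] and [j + 1]: a
    stationary chain of measures would contain [ones gT *m wmx w0], which is not
    orthogonal to [c], and a stationary chain of functions would contain
    [wmx w0 *m c], which is not orthogonal to [ones gT].  At the first [i] at
    which [rows i] meets [E], the rank of [rows i] is at least [i + m], and the
    orthogonality with [cols c (K - i)] gives [K + m + 1 <= N].  If [rows K] does
    not meet [E], the jump takes place between [rows K] and the whole space and
    gives the same inequality. *)
Lemma detecting_words (c : 'cV[rat]_N) w0 :
  word_over Sigma w0 -> ones gT *m wmx w0 *m c != 0 ->
  exists u g v, [/\ word_over Sigma u, word_over Sigma v,
    (size u + size v <= N - m)%N &
    ones gT *m wmx u *m rmx g *m (wmx v *m c) != 0].
Proof.
move=> Sw0 w0c; set K := (N - m)%N.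
suff [i [j [le_ij ne]]] :
    exists i j, (i + j <= K)%N /\ cols c j *m (rows i)^T != 0.
  have [v [Sv sv]] := wspan_mul_neq0 ne.
  rewrite mxword_tr -mulmxA -trmx_mul -trmx_mul trmx_eq0 -mulmxA => ne1.
  have [g] := rclosure_mul_neq0 ne1.
  rewrite -mulmxA => /wspan_mul_neq0[u [Su su ne2]].
  exists u, g, (rev v); split=> //.
  - by rewrite /word_over all_rev.
  - by rewrite size_rev (leq_trans _ le_ij) // leq_add.
  - by rewrite !mulmxA in ne2 *.
have [/existsP[i /existsP[j /andP[le_ij ne]]]|none] :=
  boolP [exists i : 'I_K.+1, exists j : 'I_K.+1,
            (i + j <= K)%N && (cols c j *m (rows i)^T != 0)].
  by exists i, j.
have orth i j : (i + j <= K)%N -> cols c j *m (rows i)^T = 0.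
  move=> le_ij; apply/eqP; apply: contraNT none => ne.
  have lt_i : (i < K.+1)%N by rewrite ltnS (leq_trans _ le_ij) ?leq_addr.
  have lt_j : (j < K.+1)%N by rewrite ltnS (leq_trans _ le_ij) ?leq_addl.
  by apply/existsP; exists (Ordinal lt_i); apply/existsP; exists (Ordinal lt_j);
     rewrite /= le_ij.
have N_gt0 : (0 < N)%N by apply/card_gt0P; exists 1%g.
have ones_neq0 : ones gT != 0.
  by apply/rV0Pn; exists (Ordinal N_gt0); rewrite mxE oner_eq0.
have c_neq0 : c != 0 by apply: contraNneq w0c => ->; rewrite mulmx0.
have rank_rows i : (i <= K)%N -> (i.+1 <= \rank (rows i))%N.
  move=> le_i; apply: leq_trans (mxrankS (sub_rclosure _)).
  have [|all_in] := wspan_growth Sigma (@map_mx_of gT) (ones gT) i.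
    by rewrite rank_rV ones_neq0.
  case/negP: w0c; apply/eqP/sub_kermxP.
  apply: submx_trans (all_in _ Sw0) (submx_trans (sub_rclosure _) _).
  apply/sub_kermxP; apply: (can_inj (@trmxK _ _ _)); rewrite trmx_mul trmx0.
  apply/sub_kermxP; apply: submx_trans (wspan_sub Sigma (fun s => (map_mx_of s)^T) _ 0) _.
  by apply/sub_kermxP; apply: (orth i 0); rewrite addn0.
have rank_cols j : (j <= K)%N -> (j.+1 <= \rank (cols c j))%N.
  move=> le_j.
  have [|all_in] := wspan_growth Sigma (fun s => (map_mx_of s)^T) c^T j.
    by rewrite rank_rV trmx_eq0 c_neq0.
  case/negP: w0c; apply/eqP; apply: (can_inj (@trmxK _ _ _)).
  rewrite trmx0 -mulmxA !trmx_mul.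
  apply/sub_kermxP; have := all_in (rev w0).
  rewrite all_rev mxword_tr revK => /(_ Sw0)/submx_trans; apply.
  apply/sub_kermxP; apply: (can_inj (@trmxK _ _ _)); rewrite trmx_mul trmxK trmx0.
  apply/sub_kermxP; apply: submx_trans (wspan_sub Sigma (@map_mx_of gT) _ 0) _.
  apply: submx_trans (sub_rclosure _) _; apply/sub_kermxP.
  by apply: (can_inj (@trmxK _ _ _)); rewrite trmx_mul trmxK trmx0 orth.
have rank_sum i j : (i + j <= K)%N -> (\rank (rows i) + \rank (cols c j) <= N)%N.
  by move=> le_ij; rewrite addnC -[\rank (rows i)]mxrank_tr mulmx0_rank_max ?orth.
have rows0E : (rows 0 :&: E)%MS = 0.
  apply/eqP; rewrite -submx0 -onesE capmxS //.
  by apply/sumsmx_subP => g _; rewrite /= (eqmxMr _ (genmxE _)) ones_rmx.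
have N_le : (N <= K + m)%N by rewrite addnC -leq_subLR.
have [capK|capK] := eqVneq (rows K :&: E)%MS 0.
  have := jumpE (rclosure_stable _) rstable_full (submx1 _) capK.
  rewrite cap1mx E_neq0 mxrank1 => /(_ isT); rewrite leqNgt => /negP[].
  by rewrite (leq_ltn_trans N_le) // ltn_add2r rank_rows.
have ex_i : exists i, (rows i :&: E)%MS != 0 by exists K.
case: (ex_minnP ex_i) => -[|i]; first by rewrite rows0E eqxx.
move=> cap_i1 min_i; have lt_i : (i < K)%N by apply: min_i.
have cap_i : (rows i :&: E)%MS = 0.
  by apply/eqP; apply: contraTT (ltnSn i) => /min_i; rewrite -leqNgt.
have r_jump : (\rank (rows i) + m <= \rank (rows i.+1))%N.
  apply: jumpE cap_i cap_i1; [exact: rclosure_stable..|].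
  exact/rclosureS/addsmxSl.
have le_K : (i.+1 + (K - i.+1) <= K)%N by rewrite subnKC.
have := rank_cols _ (leq_subr i.+1 K).
have := rank_rows i (ltnW lt_i).
have := rank_sum _ _ le_K.
move: r_jump N_le le_K; move: (\rank _) (\rank _) (\rank _) => x y z.
lia.
Qed.

End Extension.

(** * Enlarging subsets by preimages *)

Section ShortWords.

Local Open Scope ring_scope.

Variable gT : finGroupType.
Local Notation N := #|gT|.
Local Notation wmx := (mxword (@map_mx_of gT)).

(** The sum of all translations has rank one and factors through the value of
    the constants on [wmx v *m centred S], which is zero because [v] preserves
    the size of [S].  So the growths for the various [h] sum to zero, and one of
    them is not zero. *)
Lemma averaging u v g (S : {set gT}) :
  ones gT *m wmx u *m rmx g *m (wmx v *m centred S) != 0 ->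
  #|word_preim v S| = #|S| ->
  exists h, (#|S| < #|word_preim (u ++ right_translation h :: v) S|)%N.
Proof.
move=> neq eqS.
pose x h : rat := N%:R * (#|word_preim (u ++ right_translation h :: v) S|%:R - #|S|%:R).
have xE h : ones gT *m wmx u *m rmx h *m (wmx v *m centred S) = (x h)%:M.
  by rewrite /x -ones_wmx_centred mxword_cat /= !mulmxA.
have sum_x : \sum_h x h = 0.
  apply/eqP; rewrite -scalar1_mx_eq0; apply/eqP.
  rewrite raddf_sum -(eq_bigr _ (fun h _ => xE h)) -mulmx_suml -mulmx_sumr sum_rmx.
  rewrite -!mulmxA ones_wmx_centred eqS subrr mulr0 [0%:M]raddf0.
  by rewrite !mulmx0.
apply/existsP; apply: contraNT neq; rewrite negb_exists => /forallP no_h.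
have x_le0 h : 0 <= - x h.
  rewrite oppr_ge0 mulr_ge0_le0 ?ler0n // subr_le0 ler_nat leqNgt.
  exact: no_h.
have : \sum_h - x h == 0 by rewrite sumrN sum_x oppr0.
rewrite psumr_eq0 // => /allP/(_ g (mem_index_enum g)); rewrite oppr_eq0 => /eqP xg.
by rewrite xE xg raddf0.
Qed.

Variables (Sigma : {set {ffun gT -> gT}}) (d : nat).
Hypothesis short_words : forall g : gT, exists s, [/\ word_over Sigma s,
  (size s <= d)%N & forall x, word_act x s = (x * g)%g].

Lemma averaging_word u v g S :
  word_over Sigma u -> word_over Sigma v ->
  ones gT *m wmx u *m rmx g *m (wmx v *m centred S) != 0 ->
  #|word_preim v S| = #|S| ->
  exists w, [/\ word_over Sigma w, (size w <= size u + d + size v)%N &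
                (#|S| < #|word_preim w S|)%N].
Proof.
move=> Su Sv neq /(averaging neq)[h lt_h].
have [s [Ss ss sE]] := short_words h.
exists (u ++ s ++ v); split.
- by rewrite !word_over_cat Su Ss.
- by rewrite !size_cat -addnA leq_add2l leq_add2r.
- apply: leq_trans lt_h _; apply/eq_leq/eq_card => x.
  by rewrite !inE !word_act_cat /= ffunE sE.
Qed.

(** As long as [v = s :: v'] changes the size of [S], the shorter pair formed of
    the single letter [s] and [v'] still detects [centred S]. *)
Lemma positive_word S u g v :
  word_over Sigma u -> word_over Sigma v ->
  ones gT *m wmx u *m rmx g *m (wmx v *m centred S) != 0 ->
  exists w, [/\ word_over Sigma w, (size w <= size u + d + size v)%N &
                (#|S| < #|word_preim w S|)%N].
Proof.
elim: v u g => [|s v IHv] u g Su Sv neq.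
  apply: (averaging_word Su Sv neq).
  by apply: eq_card => x; rewrite inE.
have [eqS|neqS] := eqVneq #|word_preim (s :: v) S| #|S|.
  exact: (averaging_word Su Sv neq).
case/andP: Sv => Ss Sv.
have [||w [Sw sw ltS]] := IHv [:: s] 1%g _ Sv.
- by rewrite /word_over /= Ss.
- rewrite rmx1 /= !mulmx1 -mulmxA (mulmxA (map_mx_of s)).
  rewrite -[map_mx_of s *m _]/(wmx (s :: v)).
  rewrite ones_wmx_centred scalar1_mx_eq0 mulf_neq0 ?pnatr_eq0 -?lt0n //.
    by apply/card_gt0P; exists 1%g.
  by rewrite subr_eq0 eqr_nat.
by exists w; split=> //; rewrite (leq_trans sw) //=; lia.
Qed.

End ShortWords.

(** * Synchronizing words of quadratic length *)

Section Synchronization.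

Local Open Scope ring_scope.

Variables (gT : finGroupType) (Sigma : {set {ffun gT -> gT}}).
Variables (E : 'M[rat]_#|gT|) (m d : nat).
Hypotheses (jumpE : rank_jump E m) (E_neq0 : E != 0).
Hypothesis onesE : (ones gT :&: E)%MS = 0.
Hypothesis short_words : forall g : gT, exists s, [/\ word_over Sigma s,
  (size s <= d)%N & forall x, word_act x s = (x * g)%g].
Hypothesis le_dm : (d <= m)%N.

Local Notation N := #|gT|.

Lemma extension_word S w0 :
  word_over Sigma w0 -> word_preim w0 S = setT -> S != setT ->
  exists w, [/\ word_over Sigma w, (size w <= N)%N &
                (#|S| < #|word_preim w S|)%N].
Proof.
move=> Sw0 w0S ST.
have [|u [g [v [Su Sv suv neq]]]] :=
  detecting_words jumpE E_neq0 onesE (c := centred S) Sw0.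
  rewrite -mulmxA ones_wmx_centred w0S cardsT scalar1_mx_eq0.
  have S_lt : (#|S| < N)%N by rewrite -cardsT proper_card // properT.
  rewrite mulf_neq0 ?subr_eq0 ?eqr_nat ?pnatr_eq0 ?gtn_eqF //.
  exact: leq_ltn_trans S_lt.
have [w [Sw sw ltS]] := positive_word short_words Su Sv neq.
exists w; split=> //.
have le_mN : (m <= N)%N.
  have := jumpE (M := 0) (M' := 1%:M).
  rewrite cap0mx cap1mx mxrank0 mxrank1 add0n; apply=> //.
  - by move=> g'; apply: stable0mx.
  - exact: rstable_full.
  - exact: sub0mx.
lia.
Qed.

(** One letter merging two points, followed by at most [N - 2] enlargements of
    length at most [N], adds up to [1 + N * (N - 2)] letters. *)
Lemma short_synchronizing_word : (1 < N)%N -> synchronizing Sigma ->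
  exists2 w, synchronizing_word Sigma w & (size w <= (N - 1) ^ 2)%N.
Proof.
move=> N_gt1 [w1 [Sw1 /eqP/cards1P[y w1y]]].
have w1E x : word_act x w1 = y.
  by apply/set1P; rewrite -w1y; apply: imset_f.
have [s Ss [x1 [x2 [ne12 eq12]]]] :
    exists2 s, s \in Sigma & exists x1 x2, x1 != x2 /\ s x1 = s x2.
  have [/exists_inP[s Ss /injectivePn[x1 [x2 ne eq12]]]|] :=
      boolP [exists s in Sigma, ~~ injectiveb s].
    by exists s => //; exists x1, x2.
  rewrite negb_exists_in => /forall_inP inj_all.
  have /card_gt1P[x1 [x2 [_ _ /eqP[]]]] := N_gt1.
  have := etrans (w1E x1) (esym (w1E x2)).
  elim: (w1) Sw1 x1 x2 => [//|s w IHw] /andP[Ss Sw] x1 x2 /= /(IHw Sw).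
  by move/negbNE/injectiveP: (inj_all s Ss); apply.
pose z := s x1.
have loop t : exists w, [/\ word_over Sigma w, (size w <= 1 + N * t)%N &
                          (minn N (t + 2) <= #|word_preim w [set z]|)%N].
  elim: t => [|t [w [Sw sw cw]]].
    exists [:: s]; split=> //; first by rewrite /word_over /= Ss.
    apply: leq_trans (geq_minr _ _) _; have := cards2 x1 x2; rewrite ne12 => <-.
    by apply/subset_leq_card/subsetP => x /set2P[]->; rewrite !inE /= -?eq12.
  have [wT|wT] := eqVneq (word_preim w [set z]) setT.
    exists w; split=> //; first by rewrite (leq_trans sw) // leq_add2l leq_mul.
    by rewrite wT cardsT geq_minl.
  have /card_gt0P[y' y'S] : (0 < #|word_preim w [set z]|)%N.
    by apply: leq_trans cw; rewrite leq_min addn2 (ltnW N_gt1).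
  have [s' [Ss' _ s'E]] := short_words (y^-1 * y')%g.
  have [||w' [Sw' sw' cw']] := @extension_word (word_preim w [set z]) (w1 ++ s') _ _ wT.
  - by rewrite word_over_cat; apply/andP.
  - by apply/setP => x; rewrite inE word_act_cat w1E s'E mulKVg y'S inE.
  exists (w' ++ w); split.
  - by rewrite word_over_cat; apply/andP.
  - by rewrite size_cat mulnS; lia.
  - by rewrite word_preim_cat; lia.
have [w [Sw sw cw]] := loop (N - 2)%N.
exists w; last by rewrite (leq_trans sw) //; nia.
split=> //; apply/eqP/cards1P; exists z.
have wT : word_preim w [set z] = setT.
  apply/eqP; rewrite eqEcard subsetT cardsT /=; move: cw.
  by rewrite subnK // minnn.
have wE x : word_act x w = z.
  by have := in_setT x; rewrite -wT !inE => /eqP.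
apply/setP => x; rewrite inE; apply/imsetP/eqP => [[x' _ ->]//|->].
by exists 1%g.
Qed.

End Synchronization.

(** * Elements of bounded length over a generating set *)

Section ShortProducts.

Local Open Scope group_scope.

Variables (gT : finGroupType) (D : {set gT}).

Definition short_product (l : nat) (g : gT) : Prop :=
  exists s : seq gT, [/\ all [in D] s, size s <= l & g = \prod_(x <- s) x].

Lemma short_product_leq l l' g : l <= l' -> short_product l g -> short_product l' g.
Proof.
by move=> le_l [s [Ds sz ->]]; exists s; split=> //; apply: leq_trans le_l.
Qed.

Lemma short_product1 l : short_product l 1.
Proof. by exists [::]; rewrite big_nil. Qed.

Lemma short_product_mem g : g \in D -> short_product 1 g.
Proof. by move=> Dg; exists [:: g]; rewrite /= Dg big_seq1. Qed.

Lemma short_productM l l' g h :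
  short_product l g -> short_product l' h -> short_product (l + l') (g * h).
Proof.
move=> [s [Ds sz ->]] [s' [Ds' sz' ->]]; exists (s ++ s').
by rewrite all_cat Ds Ds' size_cat leq_add // big_cat.
Qed.

Lemma short_productX g i : g \in D -> short_product i (g ^+ i).
Proof.
move=> Dg; elim: i => [|i IHi]; first exact: short_product1.
by rewrite expgS -add1n; apply: short_productM IHi; apply: short_product_mem.
Qed.

Lemma short_product_gen l : (forall g, short_product l g) -> <<D>> = [set: gT].
Proof.
move=> all_short; apply/eqP; rewrite eqEsubset subsetT; apply/subsetP => g _.
have [s [/allP Ds _ ->]] := all_short g.
rewrite big_seq; apply: group_prod => x /Ds; exact: mem_gen.
Qed.

Lemma short_product_word (Sigma : {set {ffun gT -> gT}}) l g :
  Cayley_graph D \subset Sigma -> short_product l g ->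
  exists s, [/\ word_over Sigma s, size s <= l & forall x, word_act x s = x * g].
Proof.
move=> /subsetP DSigma [s [/allP Ds sz ->]].
exists [seq right_translation d | d <- s]; split; rewrite ?size_map //.
  by apply/allP => _ /mapP[d /Ds Dd ->]; apply/DSigma/imset_f.
elim: s {Ds sz} => [|d s IHs] x /=; first by rewrite big_nil mulg1.
by rewrite big_cons ffunE mulgA; apply: IHs.
Qed.

Lemma Cerny_of_rank_jump (E : 'M[rat]_#|gT|) m d :
  rank_jump E m -> E != 0%R -> (ones gT :&: E)%MS = 0%R ->
  1 < #|gT| -> d <= m -> (forall g, short_product d g) ->
  Cerny_Cayley_graph D.
Proof.
move=> jumpE E_neq0 onesE gT_gt1 le_dm all_short; split.
  exact: short_product_gen all_short.
move=> Sigma DSigma; apply: (short_synchronizing_word jumpE E_neq0 onesE _ le_dm) => // g.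
exact: short_product_word DSigma (all_short g).
Qed.

End ShortProducts.

(** * Permutations as products of adjacent transpositions *)

Section PermutationLengths.

Local Open Scope group_scope.

Variables (n : nat) (D : {set 'S_n.+1}) (l : nat).
Hypothesis adjacent_short : forall i, i < n ->
  short_product D l (tperm (inord i) (inord i.+1)).

Lemma tperm_short_lt i e : i + e < n ->
  short_product D (e.+1 * (2 * l)) (tperm (inord i) (inord (i + e.+1))).
Proof.
elim: e => [|e IHe] lt_n.
  rewrite addn1; apply: short_product_leq (adjacent_short _); lia.
pose t : 'S_n.+1 := tperm (inord (i + e.+1)) (inord (i + e.+1).+1).
have -> : tperm (inord i) (inord (i + e.+2)) = t * tperm (inord i) (inord (i + e.+1)) * t.
  rewrite -mulgA -[X in X * _]tpermV -/(conjg _ t) tpermJ tpermL tpermD ?addnS //;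
    rewrite -val_eqE /= !inordK; lia.
have t_short : short_product D l t by apply: adjacent_short; lia.
apply: short_product_leq (short_productM (short_productM t_short (IHe _)) t_short); lia.
Qed.

Lemma tperm_short (x y : 'I_n.+1) :
  short_product D (n * (2 * l)) (tperm x y).
Proof.
wlog le_xy : x y / x <= y.
  by move=> H; case/orP: (leq_total x y) => /H //; rewrite tpermC.
have [->|ne_xy] := eqVneq x y; first by rewrite tperm1; apply: short_product1.
have lt_xy : x < y by rewrite ltn_neqAle le_xy andbT.
have lt_y := ltn_ord y.
have yE : x + (y - x).-1.+1 = y :> nat by lia.
have lt_n : x + (y - x).-1 < n by lia.
have := tperm_short_lt lt_n; rewrite yE !inord_val; apply: short_product_leq.
by rewrite leq_mul2r; apply/orP; right; lia.
Qed.

(** Multiplication by the transposition of [x] and [s x] fixes [x] and moves no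
    point fixed by [s], so one transposition is spent for each moved point. *)
Lemma perm_short (s : 'S_n.+1) :
  short_product D (n.+1 * (n * (2 * l))) s.
Proof.
have moved c : forall s : 'S_n.+1, #|[set x | s x != x]| <= c ->
    short_product D (c * (n * (2 * l))) s.
  elim: c => [|c IHc] {}s.
    rewrite leqn0 cards_eq0 => /eqP s0.
    suff -> : s = 1 by apply: short_product1.
    apply/permP => x; rewrite perm1; apply/eqP/negbNE.
    by have := in_set0 x; rewrite -s0 inE => ->.
  have [s1|/forallPn[x sx]] := boolP [forall x, s x == x].
    suff -> : s = 1 by move=> _; apply: short_product1.
    by apply/permP => x; rewrite perm1; apply/eqP/(forallP s1).
  rewrite (cardsD1 x) inE sx add1n ltnS => le_c.
  rewrite -[s](mulgK (tperm x (s x))) tpermV mulSn addnC.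
  apply: short_productM (tperm_short _ _); apply: IHc.
  apply: leq_trans le_c; apply/subset_leq_card/subsetP => y.
  rewrite !inE permM => s'y; apply/andP; split.
    by apply: contraNneq s'y => ->; rewrite tpermR.
  apply: contraNneq s'y => sy; rewrite sy tpermD // eq_sym.
    by apply: contraNneq sx => <-; rewrite sy.
  by apply: contraNneq sx => e; apply/eqP/(@perm_inj _ s); rewrite -e.
apply: moved; rewrite -[X in _ <= X]card_ord; exact: max_card.
Qed.

End PermutationLengths.

(** * Sign patterns on blocks of four points *)

Section Blocks.

Local Open Scope group_scope.

Variables (n k : nat).
Hypothesis le_k : 4 * k <= n.+1.

(** The point number [r] of block [b]; [inord] is faithful for [b < k] and [r < 4]. *)
Definition pt (b r : nat) : 'I_n.+1 := inord (4 * b + r).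

Lemma pt_eq b c r r' : b < k -> c < k -> r < 4 -> r' < 4 ->
  (pt b r == pt c r') = (b == c) && (r == r').
Proof. by move=> lt_b lt_c lt_r lt_r'; rewrite -val_eqE /= !inordK; lia. Qed.

Definition symm (b : nat) : 'S_n.+1 := tperm (pt b 0) (pt b 1).
Definition anti (b : nat) : 'S_n.+1 := tperm (pt b 2) (pt b 3).
Definition swap (b : nat) : 'S_n.+1 :=
  tperm (pt b 0) (pt b 2) * tperm (pt b 1) (pt b 3).

Definition block (b : nat) : {set 'I_n.+1} :=
  [set pt b 0; pt b 1; pt b 2; pt b 3].

Lemma block_tperm b r r' : r < 4 -> r' < 4 ->
  perm_on (block b) (tperm (pt b r) (pt b r')).
Proof.
move=> lt_r lt_r'; apply: subset_trans (tperm_on _ _) _.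
apply/subsetP => x /set2P[]->; rewrite !inE.
  by case: r lt_r => [|[|[|[|r]]]] //; rewrite eqxx ?orbT.
by case: r' lt_r' => [|[|[|[|r']]]] //; rewrite eqxx ?orbT.
Qed.

Lemma block_swap b : perm_on (block b) (swap b).
Proof. by apply: perm_onM; apply: block_tperm. Qed.

Lemma block_disjoint b c : b < k -> c < k -> b != c ->
  [disjoint block b & block c].
Proof.
move=> lt_b lt_c ne; rewrite -setI_eq0; apply/eqP/setP => x; rewrite in_setI in_set0.
apply/negP => /andP[]; rewrite !inE -!orbA.
by case/or4P=> /eqP->; rewrite !pt_eq // (negbTE ne).
Qed.

Lemma swapK b : b < k -> swap b * swap b = 1.
Proof.
move=> lt_b; have cT : commute (tperm (pt b 0) (pt b 2)) (tperm (pt b 1) (pt b 3)).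
  apply: (perm_onC (tperm_on _ _) (tperm_on _ _)).
  rewrite -setI_eq0; apply/eqP/setP => x; rewrite in_setI in_set0.
  by apply/negP => /andP[]; rewrite !inE => /orP[]/eqP->; rewrite !pt_eq // !andbF.
by rewrite /swap mulgA -(mulgA (tperm (pt b 0) _)) -cT mulgA tperm2 mul1g tperm2.
Qed.

Lemma symmK b : symm b * symm b = 1.
Proof. exact: tperm2. Qed.

(** Exchanging the halves of a block carries its antisymmetric pair to its
    symmetric pair, which flips the eigenvalue of [symm b]. *)
Lemma swap_symm b : b < k -> swap b * symm b = anti b * swap b.
Proof.
move=> lt_b; rewrite [RHS]conjgC /anti tpermJ /swap !permM; congr (_ * tperm _ _).
  by rewrite tpermR tpermD // pt_eq // andbF.
by rewrite (tpermD (z := pt b 3)) ?tpermR // pt_eq // andbF.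
Qed.

Local Open Scope ring_scope.

Local Notation N := #|'S_n.+1|.

Definition pattern : 'M[rat]_N :=
  (\bigcap_(b < k) (eigenspace (rmx (symm b)) 1 :&: eigenspace (rmx (anti b)) (-1)))%MS.

Lemma patternP (v : 'rV[rat]_N) :
  reflect (forall b, (b < k)%N -> v *m rmx (symm b) = v /\ v *m rmx (anti b) = - v)
          (v <= pattern)%MS.
Proof.
rewrite /pattern; apply: (iffP sub_bigcapmxP) => [vE b lt_b|vE [b lt_b] _].
  have := vE (Ordinal lt_b) isT; rewrite sub_capmx /=.
  case/andP=> /eigenspaceP v1 /eigenspaceP vN1.
  by rewrite scale1r in v1; rewrite scaleN1r in vN1; split; [exact: v1|exact: vN1].
have [v1 vN1] := vE b lt_b; rewrite sub_capmx /=.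
by apply/andP; split; apply/eigenspaceP; rewrite ?scale1r ?scaleN1r.
Qed.

Lemma pattern_jump : rank_jump pattern (2 ^ k).
Proof.
move=> M M' stM stM' MM' capM /rowV0Pn[v]; rewrite sub_capmx.
case/andP=> vM' vE v_neq0.
apply: (doubling (Y := fun b => rmx (symm b)) (T := fun b => rmx (swap b))
                 _ _ _ MM' vM').
- move=> b lt_b; split; first by rewrite -rmxM symmK rmx1.
  by rewrite -rmxM (swapK lt_b) rmx1.
- move=> b c /andP[lt_bc lt_c].
  have comm_blocks s t : perm_on (block b) s -> perm_on (block c) t ->
      comm_mx (rmx s) (rmx t).
    have lt_b : (b < k)%N := ltn_trans lt_bc lt_c.
    have dis := block_disjoint lt_b lt_c (negbT (ltn_eqF lt_bc)).
    move=> bs ct; have st : (s * t = t * s)%g := perm_onC bs ct dis.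
    exact: etrans (esym (rmxM s t)) (etrans (congr1 (@rmx _) st) (rmxM t s)).
  have [bs cs] := (block_tperm b (isT : 0 < 4)%N (isT : 1 < 4)%N,
                   block_tperm c (isT : 0 < 4)%N (isT : 1 < 4)%N).
  have [bt ct] := (block_swap b, block_swap c).
  by split; apply: comm_blocks.
- by move=> b _; split; [apply: stM|apply: stM|apply: stM'|apply: stM'].
- apply: contra v_neq0 => vM; rewrite -submx0 -capM sub_capmx vM.
  exact: vE.
move=> b lt_b; have [v1 vN1] := patternP _ vE b lt_b; split=> //.
rewrite -mulmxA -(rmxM (swap b) (symm b)) (swap_symm lt_b) (rmxM (anti b)) mulmxA.
exact: etrans (congr1 (mulmx^~ _) vN1) (mulNmx _ _).
Qed.

Lemma pattern_ones : (0 < k)%N -> (ones 'S_n.+1 :&: pattern)%MS = 0.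
Proof.
move=> k_gt0; apply/eqP; rewrite -submx0; apply/rV_subP => v.
rewrite sub_capmx => /andP[/sub_rVP[a ->] /patternP/(_ 0 k_gt0)[_]].
rewrite -scalemxAl ones_rmx => /eqP; rewrite -addr_eq0 -mulr2n -scaler_nat.
by rewrite scaler_eq0 pnatr_eq0 /= => /eqP->; apply: sub0mx.
Qed.

(** Multiplying [s] on the left by [symm b] or [anti b] permutes the values of
    [s] at two points of block [b], hence this function has the required sign
    pattern once [s] is replaced by its inverse; it never vanishes because
    permutations are injective. *)
Definition antisymmetric_product (s : 'S_n.+1) : rat :=
  \prod_(b < k) ((s (pt b 2))%:R - (s (pt b 3))%:R).

Lemma antisymmetric_product_symm b s : (b < k)%N ->
  antisymmetric_product (symm b * s)%g = antisymmetric_product s.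
Proof.
move=> lt_b; apply: eq_bigr => -[c lt_c] _ /=.
by rewrite !permM !tpermD // pt_eq // andbF.
Qed.

Lemma antisymmetric_product_anti b s : (b < k)%N ->
  antisymmetric_product (anti b * s)%g = - antisymmetric_product s.
Proof.
move=> lt_b; rewrite /antisymmetric_product (bigD1 (Ordinal lt_b)) //=.
rewrite [in RHS](bigD1 (Ordinal lt_b)) //= !permM tpermL tpermR -opprB mulNr.
congr (- (_ * _)); apply: eq_bigr => -[c lt_c]; rewrite -val_eqE /= => ne.
by rewrite !permM !tpermD // pt_eq // eq_sym (negbTE ne).
Qed.

Lemma pattern_neq0 : pattern != 0.
Proof.
pose v : 'rV[rat]_N := \row_j antisymmetric_product (enum_val j)^-1%g.
apply/rowV0Pn; exists v.
  apply/patternP => b lt_b; split; apply/rowP => j.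
    rewrite row_rmx !mxE enum_rankK invMg invgK.
    by rewrite antisymmetric_product_symm.
  rewrite row_rmx !mxE enum_rankK invMg invgK.
  by rewrite antisymmetric_product_anti.
apply/rV0Pn; exists (enum_rank 1%g); rewrite mxE.
apply/prodf_neq0 => -[b lt_b] _ /=.
by rewrite subr_eq0 eqr_nat val_eqE (inj_eq perm_inj) pt_eq // andbF.
Qed.

End Blocks.

(** * The two generating sets *)

Lemma cube_le_exp2 k : 21 <= k -> 2 ^ 7 * k.+1 ^ 3 <= 2 ^ k.
Proof.
elim: k => // k IHk; rewrite leq_eqVlt => /orP[/eqP <-|lt_k].
  (* At k = 21 this is 2^10 * 11^3 <= 2^10 * 2^11. *)
  by rewrite -[22]/(2 * 11) expnMn mulnA -expnD -[21]/(7 + 3 + 11)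
             (expnD 2 (7 + 3)) leq_mul2l.
have IH := IHk lt_k; rewrite (expnS 2 k).
apply: leq_trans (leq_mul (leqnn 2) IH).
rewrite mulnCA leq_mul2l /=; rewrite !expnS expn0; nia.
Qed.

Section SymmetricGroup.

Variable n : nat.
Hypothesis n_ge : 83 <= n.

(** The length [n.+2] allowed for an adjacent transposition is that of a
    conjugate of the transposition of [0] and [1] by a power of the long cycle;
    it covers both generating sets. *)
Lemma Cerny_of_short (D : {set 'S_n.+1}) :
  (forall g, short_product D (n.+1 * (n * (2 * n.+2))) g) ->
  Cerny_Cayley_graph D.
Proof.
pose k := n.+1 %/ 4.
have le_k : 4 * k <= n.+1 by rewrite /k; lia.
have k_ge : 21 <= k by rewrite /k; lia.
apply: (Cerny_of_rank_jump (pattern_jump le_k) (pattern_neq0 le_k)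
                           (pattern_ones _ _)).
- lia.
- by rewrite card_Sn; apply: leq_trans (fact_geq _); lia.
- apply: leq_trans (cube_le_exp2 k_ge).
  have le_n : n.+2 <= 4 * k.+1 by rewrite /k; lia.
  have -> : 2 ^ 7 * k.+1 ^ 3 = 4 * k.+1 * (4 * k.+1 * (2 * (4 * k.+1))) by lia.
  by rewrite !leq_mul // ltnW // ltnW.
Qed.

Lemma long_cycleX i (x : 'I_n.+1) : val ((long_cycle n.+1 ^+ i)%g x) = (x + i) %% n.+1.
Proof.
elim: i => [|i IHi]; first by rewrite expg0 perm1 addn0 modn_small.
by rewrite expgSr permM permE /= IHi -[(_ %% _).+1]addn1 modnDml addn1 addnS.
Qed.

(** The inverse of a power of the long cycle is written as a positive power,
    since inverses of generators are not letters. *)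
Lemma long_cycle_conj i : i < n ->
  (tperm (inord i) (inord i.+1) : 'S_n.+1) =
  (long_cycle n.+1 ^+ (n.+1 - i) * tperm (inord 0) (inord 1) * long_cycle n.+1 ^+ i)%g.
Proof.
move=> lt_i; have c_inv : (long_cycle n.+1 ^+ (n.+1 - i) = (long_cycle n.+1 ^+ i)^-1)%g.
  rewrite -[RHS]mul1g; apply: (canRL (mulgK _)); rewrite -expgD.
  apply/permP => x; apply: val_inj.
  rewrite long_cycleX perm1 subnK ?modnDr ?modn_small //; lia.
rewrite c_inv -mulgA -/(conjg _ _) tpermJ.
by congr tperm; apply: val_inj; rewrite long_cycleX /= !inordK ?modn_small //; lia.
Qed.

Lemma Cerny_adjacent : Cerny_Cayley_graph (adjacent_transpositions n.+1).
Proof.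
apply: Cerny_of_short; apply: perm_short => i lt_i.
apply: short_product_leq (short_product_mem _) => //.
apply/imset2P; exists (inord i) (inord i.+1); rewrite // !inE /= !inordK //; lia.
Qed.

Lemma Cerny_transposition_cycle :
  Cerny_Cayley_graph (transposition_and_long_cycle n.+1).
Proof.
apply: Cerny_of_short; apply: perm_short => i lt_i; rewrite long_cycle_conj //.
have cD : long_cycle n.+1 \in transposition_and_long_cycle n.+1.
  by rewrite inE set11 orbT.
have tD : tperm (inord 0) (inord 1) \in transposition_and_long_cycle n.+1.
  rewrite inE; apply/orP; left; apply/imset2P.
  exists (inord 0) (inord 1); rewrite // !inE /= !inordK //; lia.
have := short_productM (short_productM (short_productX (n.+1 - i) cD)
          (short_product_mem tD)) (short_productX i cD).
apply: short_product_leq; lia.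
Qed.

End SymmetricGroup.

Theorem mainTheorem8 :
  exists N : nat, forall n : nat, N <= n ->
    Cerny_Cayley_graph (adjacent_transpositions n) /\
    Cerny_Cayley_graph (transposition_and_long_cycle n).
Proof.
(* For n >= 84 there are k = n %/ 4 >= 21 blocks, from which point on the
   diameter bound 2 (n - 1) n (n + 1) is at most 2^k. *)
exists 84 => -[//|n] n_ge.
by split; [apply: Cerny_adjacent | apply: Cerny_transposition_cycle].
Qed.
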